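(* Let $m$ be an even positive integer and let $N=\lceil\sqrt{m}\,\rceil$. Then $O\chi(D_m)=N$ if and only if $m<N^2-1$.
   Context: For even $m$, $D_m$ denotes the double star on $m$ vertices: the tree obtained from two copies of the star $K_{1,\frac{m}{2}-1}$ by adding an edge joining their two centres (roots). Two proper vertex colourings $c_1,c_2$ of a graph are orthogonal if whenever two distinct vertices receive the same colour in one colouring, they receive different colours in the other (equivalently, $v\mapsto (c_1(v),c_2(v))$ is injective). The orthogonal chromatic number $O\chi(G)$ is the minimum number $c$ such that $G$ has a pair of orthogonal proper vertex colourings each using at most $c$ colours. *)

(* Defs.v *)
(* MathComp, with the real numbers of MathComp-Analysis. *)
From HB Require Import structures.
From mathcomp Require Import all_boot all_order all_algebra.
From mathcomp Require Import reals.

Set Implicit Arguments.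
Unset Strict Implicit.
Unset Printing Implicit Defensive.

Record sgraph := SGraph {
  vertex :> finType;
  adj : rel vertex;
  adj_sym : symmetric adj;
  adj_irrefl : irreflexive adj }.

Section Colourings.
Variable G : sgraph.

Definition proper_colouring c (f : {ffun G -> 'I_c}) : bool :=
  [forall u, forall v, adj u v ==> (f u != f v)].

Definition orthogonal_colourings c (f g : {ffun G -> 'I_c}) : bool :=
  [forall u, forall v, (u != v) ==>
    ((f u == f v) ==> (g u != g v)) && ((g u == g v) ==> (f u != f v))].

(* A palette of size c: the colourings need not be surjective, so this is
   "at most c colours". *)
Definition orthogonally_colourable c : bool :=
  [exists f : {ffun G -> 'I_c}, exists g : {ffun G -> 'I_c},
    [&& proper_colouring f, proper_colouring g & orthogonal_colourings f g]].

(* Colour every vertex with its own colour, in both colourings. *)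
Lemma ex_orthogonally_colourable : exists c, orthogonally_colourable c.
Proof.
pose f := [ffun v : G => enum_rank v].
have f_neq u v : u != v -> f u != f v by rewrite !ffunE (inj_eq enum_rank_inj).
have f_proper : proper_colouring f.
  apply/forallP => u; apply/forallP => v; apply/implyP => uv; apply: f_neq.
  by apply: contraTneq uv => ->; rewrite adj_irrefl.
exists #|G|; apply/existsP; exists f; apply/existsP; exists f.
rewrite f_proper /=; apply/forallP => u; apply/forallP => v; apply/implyP => uv.
by rewrite f_neq ?implybT.
Qed.

Definition orthogonal_chromatic_number : nat :=
  ex_minn ex_orthogonally_colourable.

End Colourings.

Section Star.
Variable k : nat.

(* K_{1,k}: the centre is None, the k leaves are Some i. *)
Definition star_adj : rel (option 'I_k) :=
  fun u v => (u == None) != (v == None).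

Lemma star_adj_sym : symmetric star_adj.
Proof. by move=> u v; rewrite /star_adj eq_sym. Qed.

Lemma star_adj_irrefl : irreflexive star_adj.
Proof. by move=> u; rewrite /star_adj eqxx. Qed.

Definition star : sgraph := SGraph star_adj_sym star_adj_irrefl.

End Star.

Section JoinCopies.
Variables (G : sgraph) (r : G).

(* Two copies of G, indexed by bool, plus the edge (false, r) -- (true, r). *)
Definition join_copies_adj : rel (bool * G) :=
  fun u v => if u.1 == v.1 then adj u.2 v.2 else (u.2 == r) && (v.2 == r).

Lemma join_copies_adj_sym : symmetric join_copies_adj.
Proof.
by move=> u v; rewrite /join_copies_adj eq_sym adj_sym andbC.
Qed.

Lemma join_copies_adj_irrefl : irreflexive join_copies_adj.
Proof. by move=> u; rewrite /join_copies_adj eqxx adj_irrefl. Qed.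

Definition join_copies : sgraph :=
  SGraph join_copies_adj_sym join_copies_adj_irrefl.

End JoinCopies.

(* D_m; only meaningful for m even and positive, since ./2 and .-1 truncate. *)
Definition double_star (m : nat) : sgraph :=
  @join_copies (star m./2.-1) None.

Lemma card_double_star m : ~~ odd m -> 0 < m -> #|double_star m| = m.
Proof.
move=> m_even m_gt0; rewrite /= card_prod card_bool card_option card_ord.
have m2_gt0 : 0 < m./2 by rewrite half_gt0; case: m m_even m_gt0 => [|[]].
by rewrite prednK // mul2n even_halfK.
Qed.

(* Main.v *)
Require Import Defs.
From HB Require Import structures.
From mathcomp Require Import all_boot all_order all_algebra.
From mathcomp Require Import reals.
From mathcomp Require Import zify.

(** A pair of orthogonal proper colourings with palette ['I_c] is an injection
    of the vertices into the grid ['I_c * 'I_c] sending adjacent vertices to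
    cells in distinct rows and distinct columns. Every vertex of the double star
    is adjacent to one of the two centres, so if these sit in cells [(i, i')]
    and [(j, j')], the cells [(i, j')] and [(j, i')] stay empty; hence
    [m <= c ^ 2 - 2]. Conversely, with the centres in [(i, i)] and [(j, j)],
    the sets of cells allowed for the two sets of leaves satisfy Hall's
    condition as soon as [m <= c ^ 2 - 2]. *)

Set Implicit Arguments.
Unset Strict Implicit.
Unset Printing Implicit Defensive.

Import Order.TTheory GRing.Theory Num.Theory.

Local Open Scope ring_scope.

Lemma orthogonally_colourableP (G : sgraph) c :
  reflect (exists h : G -> 'I_c * 'I_c, injective h /\
             forall u v, adj u v -> (h u).1 != (h v).1 /\ (h u).2 != (h v).2)
          (orthogonally_colourable G c).
Proof.
apply: (iffP existsP) => [[f /existsP[g /and3P[fP gP fgP]]]|[h [h_inj hP]]].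
  exists (fun u => (f u, g u)); split=> [u v [fuv guv]|u v uv].
    apply/eqP; apply: contraT => neq_uv.
    have /forallP/(_ v)/implyP/(_ neq_uv) := forallP fgP u.
    by rewrite fuv guv !eqxx.
  have /forallP/(_ v)/implyP := forallP fP u.
  have /forallP/(_ v)/implyP := forallP gP u.
  by split; auto.
exists [ffun u => (h u).1]; apply/existsP; exists [ffun u => (h u).2].
apply/and3P; split; apply/forallP => u; apply/forallP => v; apply/implyP.
- by move=> /hP[]; rewrite !ffunE.
- by move=> /hP[]; rewrite !ffunE.
rewrite -(inj_eq h_inj) [h u]surjective_pairing [h v]surjective_pairing.
by rewrite xpair_eqE !ffunE; do 2!case: eqP.
Qed.

Lemma leq_card_orthogonally_colourable (G : sgraph) c :
  orthogonally_colourable G c -> (#|G| <= c ^ 2)%N.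
Proof.
case/orthogonally_colourableP=> h [/leq_card + _].
by rewrite card_prod card_ord mulnn.
Qed.

Lemma double_star_centre_adj m (u : double_star m) :
  exists b, adj u ((b, None) : double_star m).
Proof.
by case: u => b [i|]; [exists b|exists (~~ b)]; case: b.
Qed.

Lemma leq_double_star_colourable m c :
    ~~ odd m -> (0 < m)%N -> orthogonally_colourable (double_star m) c ->
  (m + 2 <= c ^ 2)%N.
Proof.
move=> m_even m_gt0 /orthogonally_colourableP[h [h_inj hP]].
have ctr_adj : adj ((false, None) : double_star m)
                   ((true, None) : double_star m) by [].
have [neq1 neq2] := hP _ _ ctr_adj.
set p := h (false, None) in neq1 neq2; set q := h (true, None) in neq1 neq2.
pose E := [set (p.1, q.2); (q.1, p.2)].
(* Each cell of [E] shares its row with one of [p], [q] and its column with the other, so it clashes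
   with whichever centre is adjacent to [u]. *)
have dis : [disjoint [set h u | u in predT] & E].
  apply/pred0P => x; apply/negP => /andP[/imsetP[u _ ->]].
  have [b /hP[]] := double_star_centre_adj u.
  by rewrite !inE; case: b; rewrite -/p -/q => n1 n2 /orP[] /eqP hu;
    move: n1 n2; rewrite hu /= ?eqxx.
have cardE : #|E| = 2%N by rewrite cards2 xpair_eqE (negPf neq1).
have := max_card ([set h u | u in predT] :|: E).
rewrite cardsU (disjoint_setI0 dis) cards0 subn0 cardE.
by rewrite card_imset // card_double_star // card_prod card_ord mulnn.
Qed.

(* Hall's theorem for two sets: [s] uses up [A :\: B] before it takes elements
   that [B] could also use. *)
Lemma disjoint_representatives (T : finType) (A B : {set T}) k :
    (k <= #|A|)%N -> (k <= #|B|)%N -> (k.*2 <= #|A :|: B|)%N ->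
  exists s t : seq T, [/\ size s = k, size t = k, uniq (s ++ t),
                          {subset s <= A} & {subset t <= B}].
Proof.
move=> kA kB kAB; pose l := enum (A :\: B) ++ enum (A :&: B).
have l_uniq : uniq l.
  rewrite cat_uniq !enum_uniq andbT; apply/hasPn => x.
  by rewrite !mem_enum !inE => /andP[_ ->].
have lA : l =i A.
  by move=> x; rewrite mem_cat !mem_enum !inE; do 2!case: (x \in _).
have size_l : size l = #|A| by rewrite -(card_uniqP l_uniq); apply: eq_card.
pose s := take k l.
have s_size : size s = k by rewrite size_takel // size_l.
have s_uniq : uniq s by apply: take_uniq.
have s_card : #|[set x in s]| = k by rewrite cardsE (card_uniqP s_uniq).
have : (k <= #|B :\: [set x in s]|)%N.
  (* In the first case [s] lies in [A :\: B] and takes nothing from [B]. Otherwise [s] contains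
     [A :\: B], so what it leaves of [B] is what it leaves of [A :|: B], at least [2k - k]
     elements. *)
  have [k_small|k_large] := leqP k #|A :\: B|.
    suff -> : B :\: [set x in s] = B by [].
    apply/setDidPl; rewrite disjoint_subset; apply/subsetP => x xB.
    rewrite !inE /s takel_cat -?cardE //.
    by apply: contraL xB => /mem_take; rewrite mem_enum inE => /andP[].
  have -> : B :\: [set x in s] = (A :|: B) :\: [set x in s].
    apply/setP => x; rewrite !inE; case: (boolP (x \in s)) => //= xs.
    case: (boolP (x \in B)) => [_|xB]; first by rewrite orbT.
    rewrite orbF; apply/esym/negbTE; apply: contra xs => xA.
    rewrite /s take_cat -cardE ltnNge (ltnW k_large) /=.
    by rewrite mem_cat mem_enum inE xA xB.
  have := cardsID [set x in s] (A :|: B).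
  have : (#|(A :|: B) :&: [set x in s]| <= k)%N.
    by rewrite -[leqRHS]s_card subset_leq_card ?subsetIr.
  lia.
case/card_geqP=> t [t_uniq t_size tB].
exists s, t; split=> //.
- rewrite cat_uniq s_uniq t_uniq andbT; apply/hasPn => x /tB.
  by rewrite !inE => /andP[].
- by move=> x /mem_take; rewrite lA.
- by move=> x /tB; rewrite inE => /andP[].
Qed.

(* The cells allowed for the leaves of a centre placed in [(i, i)] when the
   other centre is placed in [(j, j)]. *)
Definition leaf_cells c (i j : 'I_c) : {set 'I_c * 'I_c} :=
  setX [set~ i] [set~ i] :\ (j, j).

(** The count is [(n + 1)^2 - 1]: as [i != j], the removed cell [(j, j)] does lie in the square. *)
Lemma card_leaf_cells n (i j : 'I_n.+2) :
  i != j -> #|leaf_cells i j| = (n * n.+2)%N.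
Proof.
move=> ij; have := cardsD1 (j, j) (setX [set~ i] [set~ i]).
rewrite cardsX cardsC1 card_ord in_setX !inE eq_sym ij -/(leaf_cells i j) /=.
by move: #|_| => s; nia.
Qed.

(** Only the four cells with both coordinates in [{i, j}] are missed, and
    [(n + 2)^2 - 4 = n(n + 4)]. *)
Lemma leq_card_leaf_cellsU n (i j : 'I_n.+2) :
  i != j -> (n * n.+4 <= #|leaf_cells i j :|: leaf_cells j i|)%N.
Proof.
move=> ij; set U := _ :|: _.
have : (#|~: U| <= 4)%N.
  apply: leq_trans (card_size [:: (i, i); (i, j); (j, i); (j, j)]).
  apply/subset_leq_card/subsetP => -[x y]; rewrite !inE !xpair_eqE.
  case: (eqVneq x i) => [->|_]; rewrite ?(negPf ij) ?orbT;
    case: (eqVneq y i) => [->|_]; rewrite ?(negPf ij) ?orbT //=;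
    by do 2?case: (_ == j).
by have := cardsC U; rewrite card_prod card_ord; lia.
Qed.

Lemma double_star_colourable m c :
    ~~ odd m -> (1 < c)%N -> (m + 2 <= c ^ 2)%N ->
  orthogonally_colourable (double_star m) c.
Proof.
case: c => [|[|n]] // m_even _ m_le; apply/orthogonally_colourableP.
set k := m./2.-1.
pose ctr (b : bool) : 'I_n.+2 := if b then ord_max else ord0.
have ctrN b : ctr b != ctr (~~ b) by case: b.
have m_half := even_halfK m_even.
have [|||t0 [t1 [size0 size1 t01_uniq t0P t1P]]] :=
    @disjoint_representatives _ (leaf_cells (ctr false) (ctr true))
      (leaf_cells (ctr true) (ctr false)) k.
(* If [m > 0] then [2k = m - 2 <= (n + 2)^2 - 4 = n(n + 4)], whence also [k <= n(n + 2)]; if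
   [m = 0], truncation gives [k = 0]. *)
- by rewrite (card_leaf_cells (ctrN false)) /k; nia.
- by rewrite (card_leaf_cells (ctrN true)) /k; nia.
- by apply: leq_trans (leq_card_leaf_cellsU (ctrN false)); rewrite /k; nia.
pose t (b : bool) := if b then t1 else t0.
have t_cells b : {subset t b <= leaf_cells (ctr b) (ctr (~~ b))} by case: b.
have t_size b : size (t b) = k by case: b.
have t_uniq b : uniq (t b).
  by move: t01_uniq; rewrite cat_uniq => /and3P[? _ ?]; case: b.
have t_disjoint b x : x \in t b -> x \notin t (~~ b).
  move: t01_uniq; rewrite cat_uniq => /and3P[_ /hasPn t10 _].
  by case: b => [/t10//|]; apply: contraL => /t10.
(* The default [(ord0, ord0)] is never reached, since [t b] has length [k] and [i < k]. *)
pose h (u : double_star m) :=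
  if u.2 is Some i then nth (ord0, ord0) (t u.1) i else (ctr u.1, ctr u.1).
have h_leaf b i : h (b, Some i) \in t b by rewrite mem_nth ?t_size.
have h_cell b i := t_cells _ _ (h_leaf b i).
exists h; split.
  move=> [b [i|]] [b' [j|]] huv.
  - have eq_b : b' = b.
      apply: contraTeq (h_leaf b i); rewrite huv => /eqP b'b.
      have -> : b = ~~ b' by case: (b) (b') b'b => [] [].
      exact: t_disjoint (h_leaf _ _).
    rewrite eq_b in huv *; congr (_, Some _); apply/val_inj/eqP.
    rewrite -(nth_uniq (ord0, ord0) _ _ (t_uniq b)) ?t_size ?ltn_ord //.
    exact/eqP.
  (* A leaf avoids its own centre's cell by the excluded row, and the other centre's cell by the
     removal of [(j, j)]. *)
  - move: (h_cell b i); rewrite huv !inE /=.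
    by case: (b) (b') => [] []; rewrite /= ?eqxx /= ?andbF.
  - move: (h_cell b' j); rewrite -huv !inE /=.
    by case: (b) (b') => [] []; rewrite /= ?eqxx /= ?andbF.
  - by case: b b' huv => [] [].
move=> [b [i|]] [b' [j|]]; rewrite /= /join_copies_adj /=.
- by case: eqP.
- case: eqP => // <- _; move: (h_cell b i); rewrite !inE => /and3P[_ ? ?].
  by split.
- case: eqP => // -> _; move: (h_cell b' j); rewrite !inE => /and3P[_ ? ?].
  by split; rewrite eq_sym.
- by case: b b' => [] [].
Qed.

Theorem theorem4 (R : realType) (m N : nat)
    (m_even : ~~ odd m) (m_gt0 : (0 < m)%N)
    (N_ceil : N%:Z = Num.ceil (Num.sqrt (m%:R : R))) :
  orthogonal_chromatic_number (double_star m) = N <-> (m < N ^ 2 - 1)%N.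
Proof.
have N_min c : (m <= c ^ 2)%N -> (N <= c)%N.
  move=> m_le; rewrite -lez_nat N_ceil ceil_le_int -pmulrn.
  rewrite -[leRHS]ger0_norm // -sqrtr_sqr ler_sqrt ?sqr_ge0 //.
  by rewrite -natrX ler_nat.
rewrite /orthogonal_chromatic_number; case: ex_minnP => c c_col c_min; split.
  by move=> <-; have := leq_double_star_colourable m_even m_gt0 c_col; lia.
(* Here [N <= c] is mere counting: [m] distinct cells need [m <= c ^ 2]. *)
move=> m_lt; apply/eqP; rewrite eqn_leq N_min ?andbT; last first.
  by have := leq_card_orthogonally_colourable c_col; rewrite card_double_star.
(* The side condition [1 < N] holds because [0 < m < N ^ 2 - 1] forces [N ^ 2 >= 3]. *)
by apply/c_min/double_star_colourable => //; nia.
Qed.
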